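(* Let $G,H$ be groups and let $m\ge2$ be an integer. (1) If $\mathrm{cc}_m(G)$ and $\mathrm{cc}_m(H)$ are finite, then $\mathrm{cc}_m(G\ast H)=\mathrm{cc}_m(G)+\mathrm{cc}_m(H)$, where $G\ast H$ is the free product. (2) If for every pair $(k,l)$ of positive integers with $\mathrm{lcm}(k,l)=m$ the values $\mathrm{cc}_k(G)$ and $\mathrm{cc}_l(H)$ are finite, then $\mathrm{cc}_m(G\times H)$ is also finite and $$\mathrm{cc}_m(G\times H)=\sum_{\substack{(k,l)\in\mathbb N\times\mathbb N\\ \mathrm{lcm}(k,l)=m}}\mathrm{cc}_k(G)\cdot\mathrm{cc}_l(H).$$ In particular, for a prime number $p$ (with $\mathrm{cc}_p(G)$ and $\mathrm{cc}_p(H)$ finite), $$\mathrm{cc}_p(G\times H)=\mathrm{cc}_p(G)+\mathrm{cc}_p(H)+\mathrm{cc}_p(G)\cdot\mathrm{cc}_p(H).$$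
   Context: For a group $G$ and a positive integer $m$, $\mathrm{cc}_m(G)$ denotes the number of conjugacy classes of elements of $G$ of order exactly $m$ (so $\mathrm{cc}_1(G)=1$). Here $\mathbb N$ denotes the positive integers. *)

(* Defs.v *)
From HB Require Import structures.
From mathcomp Require Import all_boot finmap.
From mathcomp Require Import boolp classical_sets functions cardinality fsbigop.

Set Implicit Arguments.
Unset Strict Implicit.
Unset Printing Implicit Defensive.

Import Algebra.

(* A groupType is an arbitrary, possibly infinite, group; the direct product
   is the library's groupType structure on (G * H)%type. *)

Section ConjugacyClasses.
Local Open Scope group_scope.
Variable G : groupType.

Definition has_order (m : nat) (x : G) : Prop :=
  [/\ (0 < m)%N, x ^+ m = 1 & forall k, (0 < k < m)%N -> x ^+ k <> 1].

Definition conj_class (x : G) : set G := [set x ^ g | g in [set: G]]%classic.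

Definition classes_of_order (m : nat) : set (set G) :=
  [set conj_class x | x in [set x | has_order m x]]%classic.

End ConjugacyClasses.

Arguments classes_of_order : clear implicits.

Definition cc_finite (m : nat) (G : groupType) : Prop :=
  finite_set (classes_of_order G m).

(* Only meaningful under cc_finite m G: fset_set sends infinite sets to
   fset0. *)
Definition cc (m : nat) (G : groupType) : nat :=
  #|` fset_set (classes_of_order G m)|%fset.

(* The free product, as the group of reduced words: sequences of non-identity
   elements of G or H in which adjacent letters come from different factors. *)
Section ReducedWords.
Local Open Scope group_scope.
Variables G H : groupType.
Implicit Types (a b c : G + H) (u v w : seq (G + H)).

Definition is_left a := if a is inl _ then true else false.

Definition letter1 a := match a with inl x => x == 1 | inr y => y == 1 end.

Definition letterV a : G + H :=
  match a with inl x => inl x^-1 | inr y => inr y^-1 end.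

Definition letterM a b : option (G + H) :=
  match a, b with
  | inl x, inl x' => Some (inl (x * x'))
  | inr y, inr y' => Some (inr (y * y'))
  | _, _ => None
  end.

Definition reduced w :=
  all (predC letter1) w && sorted (fun a b => is_left a != is_left b) w.

(* Left multiplication of a reduced word by one letter. *)
Definition lmul a w : seq (G + H) :=
  if letter1 a then w else
  if w is b :: w' then
    if letterM a b is Some c then (if letter1 c then w' else c :: w')
    else a :: w
  else [:: a].

Definition wordM u v := foldr lmul v u.

Definition wordV w := rev (map letterV w).

Lemma reduced_tl a w : reduced (a :: w) -> reduced w.
Proof.
by case/andP=> /= /andP[_ nw] /path_sorted sw; rewrite /reduced nw sw.
Qed.

Lemma reduced_cons a b w :
  reduced (a :: b :: w) =
  [&& ~~ letter1 a, is_left a != is_left b & reduced (b :: w)].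
Proof. by rewrite /reduced /= andbACA -andbA. Qed.

Lemma reduced1 a : reduced [:: a] = ~~ letter1 a.
Proof. by rewrite /reduced /= !andbT. Qed.

Lemma reduced_hd a w : reduced (a :: w) -> letter1 a = false.
Proof. by case/andP=> /= /andP[/negbTE]. Qed.

Lemma reduced_subst a c w : is_left a = is_left c -> ~~ letter1 c ->
  reduced (a :: w) -> reduced (c :: w).
Proof.
case: w => [|b w] e nc; first by rewrite !reduced1.
by rewrite !reduced_cons nc -e => /and3P[_ -> ->].
Qed.

Lemma letterM_left a b c : letterM a b = Some c -> is_left b = is_left c.
Proof. by case: a b => [x|x] [y|y] //= [<-]. Qed.

Lemma letterM_None a b : letterM a b = None -> is_left a != is_left b.
Proof. by case: a b => [x|x] [y|y]. Qed.

Lemma reduced_lmul a w : reduced w -> reduced (lmul a w).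
Proof.
rewrite /lmul; case: ifPn => // na; case: w => [|b w] rw.
  by rewrite reduced1.
case E: letterM => [c|]; last by rewrite reduced_cons na (letterM_None E).
case: ifPn => [_|nc]; first exact: reduced_tl rw.
exact: reduced_subst (letterM_left E) nc rw.
Qed.

Lemma reduced_wordM u v : reduced v -> reduced (wordM u v).
Proof. by move=> rv; elim: u => //= a u; exact: reduced_lmul. Qed.

Lemma reduced_wordV w : reduced w -> reduced (wordV w).
Proof.
case/andP=> nw sw; rewrite /reduced /wordV all_rev all_map rev_sorted.
apply/andP; split.
  by apply: sub_all nw => -[x|x] /=; rewrite invg_eq1.
rewrite sorted_map; apply: sub_sorted sw.
by case=> [x|x] [y|y].
Qed.

Lemma lmulM a b c w : letterM a b = Some c -> reduced w ->
  lmul a (lmul b w) = lmul c w.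
Proof.
case: a b => [x|x] [y|y] //= [<-] rw; rewrite /lmul /=;
  (have [->|nx] := eqVneq x 1; first by rewrite mul1g);
  (have [->|ny] := eqVneq y 1; first by rewrite mulg1 (negbTE nx));
  case: w rw => [|[z|z] w] rw /=; try by [].
all: rewrite ?mulgA.
all: try by case: eqP.
- have [e|nyz] := eqVneq (y * z) 1.
    have [e'|nxy] := eqVneq (x * y) 1.
      have -> : x = z by rewrite -[z]mul1g -e' -mulgA e mulg1.
      by case: w rw => [//|[t|t] w]; rewrite reduced_cons //= andbF.
    rewrite -mulgA e mulg1 (negbTE nx).
    by case: w rw => [//|[t|t] w]; rewrite reduced_cons //= andbF.
  rewrite mulgA; have [e'|nxy] := eqVneq (x * y) 1; last by [].
  by rewrite e' mul1g (negbTE (negbT (reduced_hd rw))).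
- have [e|nyz] := eqVneq (y * z) 1.
    have [e'|nxy] := eqVneq (x * y) 1.
      have -> : x = z by rewrite -[z]mul1g -e' -mulgA e mulg1.
      by case: w rw => [//|[t|t] w]; rewrite reduced_cons //= andbF.
    rewrite -mulgA e mulg1 (negbTE nx).
    by case: w rw => [//|[t|t] w]; rewrite reduced_cons //= andbF.
  rewrite mulgA; have [e'|nxy] := eqVneq (x * y) 1; last by [].
  by rewrite e' mul1g (negbTE (negbT (reduced_hd rw))).
Qed.

Lemma lmul1 a w : letter1 a -> lmul a w = w.
Proof. by rewrite /lmul => ->. Qed.

Lemma wordM_lmul a v w : reduced w ->
  wordM (lmul a v) w = lmul a (wordM v w).
Proof.
move=> rw; rewrite {1}/lmul; case: ifPn => [/lmul1 -> //|na].
case: v => [//|b v] /=; case E: letterM => [c|//].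
rewrite (lmulM E) ?reduced_wordM //.
by case: ifPn => // /lmul1 ->.
Qed.

Lemma wordMA u v w : reduced w -> wordM u (wordM v w) = wordM (wordM u v) w.
Proof. by move=> rw; elim: u => //= a u ->; rewrite wordM_lmul. Qed.

Lemma wordM0 w : reduced w -> wordM w [::] = w.
Proof.
elim: w => //= a w IH rw; rewrite IH ?(reduced_tl rw) // /lmul.
case: w rw {IH} => [|b w]; first by rewrite reduced1 => /negbTE ->.
rewrite reduced_cons => /and3P[/negbTE-> sab _].
by case: a b sab => [x|x] [y|y].
Qed.

Lemma wordMV w : reduced w -> wordM (wordV w) w = [::].
Proof.
elim: w => //= a w IH rw; rewrite /wordM /wordV /= rev_cons foldr_rcons.
have -> : lmul (letterV a) (a :: w) = w; last exact/IH/(reduced_tl rw).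
rewrite /lmul; case: a rw => x /reduced_hd /= nx.
  by rewrite invg_eq1 nx mulVg eqxx.
by rewrite invg_eq1 nx mulVg eqxx.
Qed.

Lemma wordVK : involutive wordV.
Proof.
move=> w; rewrite /wordV map_rev revK -map_comp map_id_in //.
by case=> x _ /=; rewrite invgK.
Qed.

End ReducedWords.

Record free_prod (G H : groupType) :=
  FreeProd { fp_word :> seq (G + H); fp_wordP : reduced fp_word }.

HB.instance Definition _ (G H : groupType) := [isSub for @fp_word G H].
HB.instance Definition _ (G H : groupType) :=
  [Choice of free_prod G H by <:].

Section FreeProduct.
Variables G H : groupType.
Implicit Types u v w : free_prod G H.

Definition fp_one : free_prod G H := @FreeProd G H [::] isT.
Definition fp_mul u v : free_prod G H :=
  FreeProd (reduced_wordM u (fp_wordP v)).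
Definition fp_inv u : free_prod G H := FreeProd (reduced_wordV (fp_wordP u)).

Lemma fp_mulA : associative fp_mul.
Proof. by move=> u v w; apply/val_inj/wordMA/fp_wordP. Qed.

Lemma fp_mul1 : left_id fp_one fp_mul.
Proof. by move=> u; apply/val_inj. Qed.

Lemma fp_mulr1 : right_id fp_one fp_mul.
Proof. by move=> u; apply/val_inj/wordM0/fp_wordP. Qed.

Lemma fp_mulV : left_inverse fp_one fp_inv fp_mul.
Proof. by move=> u; apply/val_inj/wordMV/fp_wordP. Qed.

Lemma fp_mulrV : right_inverse fp_one fp_inv fp_mul.
Proof.
move=> u; apply/val_inj => /=.
by rewrite -{1}[fp_word u]wordVK wordMV // reduced_wordV // fp_wordP.
Qed.

HB.instance Definition _ := isGroup.Build (free_prod G H)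
  fp_mulA fp_mul1 fp_mulr1 fp_mulV fp_mulrV.

End FreeProduct.

Section UniversalProperty.
Local Open Scope group_scope.
Variables G H : groupType.

Lemma reduced_lmul0 (a : G + H) : reduced (lmul a [::]).
Proof. exact: reduced_lmul. Qed.

Lemma lmul0M (a b c : G + H) : letterM a b = Some c ->
  lmul c [::] = wordM (lmul a [::]) (lmul b [::]).
Proof. by move=> abc; rewrite wordM_lmul ?reduced_lmul //= (lmulM abc). Qed.

Definition fp_inl (x : G) : free_prod G H := FreeProd (reduced_lmul0 (inl x)).
Definition fp_inr (y : H) : free_prod G H := FreeProd (reduced_lmul0 (inr y)).

Lemma fp_inlM : {morph fp_inl : x y / x * y}.
Proof.
by move=> x y; apply/val_inj/lmul0M.
Qed.

Lemma fp_inrM : {morph fp_inr : x y / x * y}.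
Proof.
by move=> x y; apply/val_inj/lmul0M.
Qed.

HB.instance Definition _ := isMultiplicative.Build G (free_prod G H) fp_inl fp_inlM.
HB.instance Definition _ := isMultiplicative.Build H (free_prod G H) fp_inr fp_inrM.

Section Lift.
Variables (K : groupType) (f : {multiplicative G -> K}) (g : {multiplicative H -> K}).

Let ev (a : G + H) : K := match a with inl x => f x | inr y => g y end.
Let lift (w : seq (G + H)) : K := foldr (fun a z => ev a * z) 1 w.

Lemma free_prod_universal :
  exists phi : {multiplicative free_prod G H -> K},
    [/\ phi \o fp_inl =1 f, phi \o fp_inr =1 g &
     forall psi : {multiplicative free_prod G H -> K},
       psi \o fp_inl =1 f -> psi \o fp_inr =1 g -> psi =1 phi].
Proof.
have m1 (L M : groupType) (h : {multiplicative L -> M}) : h 1 = 1.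
  by apply: (mulgI (h 1)); rewrite -gmulfM !mulg1.
have ev1 a : letter1 a -> ev a = 1 by case: a => x /= /eqP ->; exact: m1.
have evM a b c : letterM a b = Some c -> ev c = ev a * ev b.
  by case: a b => [x|x] [y|y] //= [<-] /=; rewrite gmulfM.
have liftl a w : lift (lmul a w) = ev a * lift w.
  rewrite /lmul; case: ifPn => [/ev1->|_]; first by rewrite mul1g.
  case: w => [//|b w]; case E: letterM => [c|//] /=.
  by rewrite mulgA -(evM _ _ _ E); case: ifPn => // /ev1 ->; rewrite mul1g.
have liftM : {morph (fun w : free_prod G H => lift w) : u v / u * v}.
  move=> [u ru] v /=; elim: u {ru} => /= [|a u IH]; first by rewrite mul1g.
  by rewrite liftl IH mulgA.
pose phiM := isMultiplicative.Build _ _ (fun w : free_prod G H => lift w) liftM.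
pose phi : {multiplicative free_prod G H -> K} :=
  HB.pack (fun w : free_prod G H => lift w) phiM.
exists phi; split=> [x|y|psi pl pr [w rw]] /=.
- by rewrite liftl /= mulg1.
- by rewrite liftl /= mulg1.
elim: w rw => [|a w IH] rw /=.
  by rewrite -(m1 _ _ psi); congr (psi _); apply/val_inj.
rewrite -(IH (reduced_tl rw)).
have -> : FreeProd rw = match a with inl x => fp_inl x | inr y => fp_inr y end
                        * FreeProd (reduced_tl rw).
  have e : a :: w = wordM (lmul a [::]) w.
    rewrite wordM_lmul ?(reduced_tl rw) // -[LHS](wordM0 rw) /=.
    by rewrite -/(wordM w [::]) (wordM0 (reduced_tl rw)).
  by apply/val_inj; rewrite [LHS]e {e}; case: a rw.
rewrite gmulfM; congr (_ * _).
by case: a {rw} => x /=; [rewrite -pl | rewrite -pr].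
Qed.

End Lift.
End UniversalProperty.

(* Main.v *)
(** Direct product: the order of (x, y) is the lcm of the orders of x and y, and
    its conjugacy class is the product of the classes of x and y, so the classes
    of order m are the products of a class of order k with one of order l,
    disjointly over the pairs with lcm(k, l) = m.

    Free product: a torsion element is conjugate to a single letter.  If the
    first and last letters of a reduced word lie in the same factor, conjugating
    by the first letter shortens the word; if they lie in different factors, no
    cancellation occurs in its powers, which are therefore nontrivial.  The
    retractions of the free product onto G and H show that two elements of a
    factor are conjugate there as soon as they are conjugate in the free
    product, and that nontrivial elements of G and of H are never conjugate. *)

Require Import Defs.
From HB Require Import structures.
From mathcomp Require Import all_boot finmap.
From mathcomp Require Import boolp classical_sets functions cardinality fsbigop.

Set Implicit Arguments.
Unset Strict Implicit.
Unset Printing Implicit Defensive.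

(** * Counting finite sets *)

Section FiniteCardinality.
Local Open Scope classical_set_scope.

(** Writing cardinalities as finitely supported sums lets the counting rules below follow from
    reindexing, splitting and nesting of such sums. *)
Lemma card_fsbig (T : choiceType) (A : set T) : finite_set A ->
  #|` fset_set A|%fset = \big[addn/0]_(x \in A) 1.
Proof. by move=> fA; rewrite fsbig_finite // card_fset_sum1. Qed.

Lemma card_fset_set_image (T U : choiceType) (f : T -> U) (A : set T) :
  finite_set A -> set_inj A f ->
  #|` fset_set (f @` A)|%fset = #|` fset_set A|%fset.
Proof.
move=> fA fI; rewrite !card_fsbig //; last exact: finite_image.
by rewrite fsbig_image.
Qed.

Lemma card_fset_setU (T : choiceType) (A B : set T) :
  finite_set A -> finite_set B -> A `&` B `<=` set0 ->
  #|` fset_set (A `|` B)|%fset = #|` fset_set A|%fset + #|` fset_set B|%fset.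
Proof.
move=> fA fB AB; rewrite !card_fsbig ?finite_setU //.
exact: (fsbigU0 addn).
Qed.

Lemma card_fset_setX (T U : choiceType) (A : set T) (B : set U) :
  finite_set A -> finite_set B ->
  #|` fset_set (A `*` B)|%fset = #|` fset_set A|%fset * #|` fset_set B|%fset.
Proof.
move=> fA fB; rewrite [LHS]card_fsbig; last exact: finite_setX.
rewrite -(pair_fsbig addn (fun _ _ => 1)) // -(card_fsbig fB).
by rewrite fsbig_finite // big_const_seq iter_addn_0 count_predT mulnC.
Qed.

Lemma card_fset_set_bigcup (I T : choiceType) (D : set I) (F : I -> set T) :
  finite_set D -> (forall i, D i -> finite_set (F i)) -> trivIset D F ->
  #|` fset_set (\bigcup_(i in D) F i)|%fset =
  \big[addn/0]_(i \in D) #|` fset_set (F i)|%fset.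
Proof.
move=> fD; rewrite fsbig_finite // -{1 2 3}(fset_setK fD).
(* The induction runs over the list enumerating [D]; since it has no repetitions, [trivIset] makes
   the head term disjoint from the union over the tail. *)
have : uniq (fset_set D) by [].
rewrite -[[set` fset_set D]]/[set` enum_fset (fset_set D)].
elim: (enum_fset (fset_set D)) => [|i r IH] /= => [_ _ _|/andP[ir ur] fF tF].
  by rewrite big_nil set_nil bigcup_set0 fset_set0.
have fr j : j \in r -> finite_set (F j).
  by move=> jr; apply: fF; rewrite /= inE jr orbT.
have -> : [set` i :: r] = i |` [set` r].
  by apply/seteqP; split=> j /=; rewrite inE; [case/predU1P; [left|right]|
    case=> ->; rewrite ?eqxx ?orbT].
rewrite big_cons bigcup_setU1 card_fset_setU; first last.
- move=> x [Fix [j /= jr Fjx]].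
  have ij : i = j.
    by apply: tF; rewrite /= ?inE ?eqxx ?jr ?orbT //; exists x.
  by rewrite ij jr in ir.
- by apply: bigcup_finite => //; exact: finite_seq.
- by apply: fF; rewrite /= inE eqxx.
congr (_ + _); apply: IH => // j k /= jr kr.
by apply: tF; rewrite /= inE ?jr ?kr orbT.
Qed.

End FiniteCardinality.

Import Algebra.

(** * Orders of elements *)

Section Order.
Local Open Scope group_scope.

(** Euclidean division turns minimality of [m] into divisibility. In this form the order depends
    only on which powers are trivial, so its invariance under injective morphisms and conjugation is
    immediate. *)
Lemma has_orderP {G : groupType} {m : nat} {x : G} :
  has_order m x <-> (0 < m)%N /\ forall n, x ^+ n = 1 <-> m %| n.
Proof.
split=> [[m0 xm min]|[m0 xm]]; last first.
  split=> // [|k /andP[k0 km] /xm /(dvdn_leq k0)]; first exact/xm.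
  by rewrite leqNgt km.
split=> // n; split=> [xn|/dvdnP[k ->]]; last by rewrite mulnC expgnA xm expg1n.
have : x ^+ (n %% m) = 1.
  by move: xn; rewrite {1}(divn_eq n m) expgnDr mulnC expgnA xm expg1n mul1g.
rewrite /dvdn; case: (posnP (n %% m)) => // r0 /min.
by rewrite r0 ltn_mod m0; case.
Qed.

Lemma has_order_unique (G : groupType) (k l : nat) (x : G) :
  has_order k x -> has_order l x -> k = l.
Proof.
move=> /has_orderP[_ kx] /has_orderP[_ lx]; apply/eqP; rewrite eqn_dvd.
by apply/andP; split; [apply/kx/lx | apply/lx/kx].
Qed.

Lemma has_order_inj (G K : groupType) (f : UMagmaMorphism.type G K) m x :
  injective f -> has_order m (f x) <-> has_order m x.
Proof.
move=> fI; have fX n : f x ^+ n = 1 <-> x ^+ n = 1.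
  by rewrite -gmulfXn -(gmulf1 (s := f)); split=> [/fI//|->].
by rewrite !has_orderP; split=> -[m0 xm]; split=> // n; rewrite -xm fX.
Qed.

Lemma has_orderJ (G : groupType) m (x g : G) :
  has_order m (x ^ g) <-> has_order m x.
Proof.
have fX n : (x ^ g) ^+ n = 1 <-> x ^+ n = 1.
  by rewrite -conjXg; split=> [/eqP|->]; rewrite ?conjg_eq1 ?conj1g // => /eqP.
by rewrite !has_orderP; split=> -[m0 xm]; split=> // n; rewrite -xm fX.
Qed.

Lemma has_order1 (G : groupType) (x : G) : has_order 1 x <-> x = 1.
Proof. by split=> [[]//|->]; split=> // -[|[]]. Qed.

Lemma torsion_has_order (G : groupType) n (x : G) :
  (0 < n)%N -> x ^+ n = 1 -> exists m, has_order m x.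
Proof.
move=> n0 xn; have ex : exists k, (0 < k)%N && (x ^+ k == 1).
  by exists n; rewrite n0 xn eqxx.
case: (ex_minnP ex) => k /andP[k0 /eqP xk] kmin; exists k; split=> // l.
move=> /andP[l0 lk] xl; move: (kmin l); rewrite l0 xl eqxx => /(_ isT).
by rewrite leqNgt lk.
Qed.

Lemma pair_expg (G H : groupType) (x : G) (y : H) n :
  (x, y) ^+ n = (x ^+ n, y ^+ n).
Proof. by elim: n => // n IH; rewrite !expgS IH. Qed.

(** A power of [(x, y)] is trivial iff both orders divide the exponent, that is, iff their lcm does.
    Conversely both components are killed by the exponent [m], hence have orders, and uniqueness of
    the order identifies the lcm with [m]. *)
Lemma has_order_pair {G H : groupType} {x : G} {y : H} {m} :
  has_order m (x, y) <->
  exists k l, [/\ has_order k x, has_order l y & lcmn k l = m].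
Proof.
have lcm_order k l : has_order k x -> has_order l y ->
    has_order (lcmn k l) (x, y).
  move=> /has_orderP[k0 xk] /has_orderP[l0 yl]; apply/has_orderP.
  rewrite lcmn_gt0 k0 l0; split=> // n; rewrite pair_expg dvdn_lcm.
  by split=> [[/xk -> /yl ->]//|/andP[/xk -> /yl ->]].
split=> [xy|[k [l [xk yl <-]]]]; last exact: lcm_order.
have [m0 xym _] := xy; move: xym; rewrite pair_expg => -[xm ym].
have [k xk] := torsion_has_order m0 xm.
have [l yl] := torsion_has_order m0 ym.
by exists k, l; split=> //; apply: has_order_unique xy; exact: lcm_order.
Qed.

End Order.

(** * Conjugacy classes of elements of a given order *)

Section Classes.
Local Open Scope group_scope.
Local Open Scope classical_set_scope.

Lemma conj_class_refl (G : groupType) (x : G) : conj_class x x.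
Proof. by exists 1; rewrite ?conjg1. Qed.

Lemma conj_classJ (G : groupType) (x g : G) : conj_class (x ^ g) = conj_class x.
Proof.
apply/seteqP; split=> _ [h _ <-]; first by exists (g * h); rewrite ?conjgM.
by exists (g^-1 * h); rewrite // conjgM conjgK.
Qed.

Lemma classes_of_order_unique (G : groupType) k l (A : set G) :
  classes_of_order G k A -> classes_of_order G l A -> k = l.
Proof.
move=> [x xk <-] [y yl yx]; have := conj_class_refl x.
rewrite -yx => -[g _ ygx]; apply: has_order_unique xk _.
by rewrite -ygx has_orderJ.
Qed.

Lemma classes_of_order_eqP (G : groupType) m (A : set G) x :
  classes_of_order G m A -> A x -> A = conj_class x.
Proof. by move=> [y _ <-] [g _ <-]; rewrite conj_classJ. Qed.

Lemma classes_of_order_neq0 (G : groupType) m (A : set G) :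
  classes_of_order G m A -> exists x, A x.
Proof. by move=> [x _ <-]; exists x; exact: conj_class_refl. Qed.

Lemma classes_of_order1 (G : groupType) :
  classes_of_order G 1%N = [set conj_class (1 : G)].
Proof.
apply/seteqP; split=> [_ [x /= /has_order1 -> <-]//|_ ->].
by exists 1 => //; exact/has_order1.
Qed.

Lemma cc_finite1 (G : groupType) : cc_finite 1%N G.
Proof. by rewrite /cc_finite classes_of_order1; exact: finite_set1. Qed.

Lemma cc1 (G : groupType) : cc 1%N G = 1%N.
Proof. by rewrite /cc classes_of_order1 fset_set1 cardfs1. Qed.

Lemma conj_class_pair (G H : groupType) (x : G) (y : H) :
  conj_class (x, y) = conj_class x `*` conj_class y.
Proof.
apply/seteqP; split=> [_ [[g h] _ <-]|[_ _] [/= [g _ <-] [h _ <-]]].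
  by split; [exists g | exists h].
by exists (g, h).
Qed.

End Classes.

(** * Direct products *)

Section DirectProduct.
Local Open Scope classical_set_scope.
Variables G H : groupType.

Definition lcm_pairs (m : nat) : set (nat * nat) :=
  [set p | [/\ 0 < p.1, 0 < p.2 & lcmn p.1 p.2 = m]].

Definition class_pairs (p : nat * nat) : set (set G * set H) :=
  classes_of_order G p.1 `*` classes_of_order H p.2.

Lemma finite_lcm_pairs m : 0 < m -> finite_set (lcm_pairs m).
Proof.
(* Both entries divide [m], hence are at most [m]. *)
move=> m0; apply: (@sub_finite_set _ _ (`I_m.+1 `*` `I_m.+1)).
  move=> [k l] /= [_ _ klm].
  by split; rewrite /= ltnS dvdn_leq // -klm ?dvdn_lcml ?dvdn_lcmr.
by apply: finite_setX; exact: finite_II.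
Qed.

Lemma classes_of_order_prod m : 0 < m ->
  classes_of_order (G * H)%type m =
  (fun AB : set G * set H => AB.1 `*` AB.2) @`
    \bigcup_(p in lcm_pairs m) class_pairs p.
Proof.
move=> m0; apply/seteqP; split=> [_ [[x y] /= xy <-]|].
  have [k [l [xk yl klm]]] := has_order_pair.1 xy.
  exists (conj_class x, conj_class y); last by rewrite conj_class_pair.
  exists (k, l) => /=; last by split; [exists x | exists y].
  by split=> //; [case: xk | case: yl].
move=> _ [_ [[k l] [/= k0 l0 klm]] [[x xk <-] [y yl <-]] <-].
exists (x, y); last exact: conj_class_pair.
by apply/has_order_pair; exists k, l.
Qed.

(** Classes are nonempty, so a point of the common product lies in both factors on each side, and a
    class is determined by any of its elements. *)
Lemma setX_class_pairs_inj m :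
  set_inj (\bigcup_(p in lcm_pairs m) class_pairs p)
    (fun AB : set G * set H => AB.1 `*` AB.2).
Proof.
move=> [A B] [A' B'] /set_mem[p _ [/= Ap Bp]] /set_mem[q _ [/= Aq Bq]] e.
have [x Ax] := classes_of_order_neq0 Ap.
have [y By] := classes_of_order_neq0 Bp.
have [/= A'x B'y] : (A' `*` B') (x, y) by rewrite -e.
rewrite (classes_of_order_eqP Ap Ax) (classes_of_order_eqP Aq A'x).
by rewrite (classes_of_order_eqP Bp By) (classes_of_order_eqP Bq B'y).
Qed.

Lemma trivIset_class_pairs (D : set (nat * nat)) : trivIset D class_pairs.
Proof.
move=> [k l] [k' l'] _ _ [[A B] [[/= Ak Bl] [/= Ak' Bl']]].
by rewrite (classes_of_order_unique Ak Ak') (classes_of_order_unique Bl Bl').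
Qed.

(** Injectivity of the product map reduces the count to the union of the [class_pairs]; disjointness
    splits it into a sum, and each summand counts a Cartesian product. *)
Lemma cc_prod m : 0 < m ->
  (forall k l : nat, 0 < k -> 0 < l -> lcmn k l = m ->
     cc_finite k G /\ cc_finite l H) ->
  cc_finite m (G * H)%type /\
  cc m (G * H)%type = \big[addn/0]_(p \in lcm_pairs m) (cc p.1 G * cc p.2 H).
Proof.
move=> m0 fGH.
have fp p : lcm_pairs m p -> finite_set (class_pairs p).
  case: p => k l [/= k0 l0 klm]; have [] := fGH k l k0 l0 klm.
  exact: finite_setX.
have fU : finite_set (\bigcup_(p in lcm_pairs m) class_pairs p).
  by apply: bigcup_finite => //; exact: finite_lcm_pairs.
rewrite /cc_finite /cc classes_of_order_prod //.
split; first exact: finite_image.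
rewrite card_fset_set_image //; last exact: setX_class_pairs_inj.
rewrite card_fset_set_bigcup //; first last.
- exact: trivIset_class_pairs.
- exact: finite_lcm_pairs.
apply: eq_fsbigr => -[k l] /set_mem[/= k0 l0 klm].
by have [fk fl] := fGH k l k0 l0 klm; exact: card_fset_setX.
Qed.

Lemma lcm_pairs_prime p : prime p ->
  lcm_pairs p = [set` [:: (p, 1); (1, p); (p, p)]].
Proof.
move=> pp; have p0 := prime_gt0 pp.
apply/seteqP; split=> [[k l] /= [k0 l0 klp]|[k l] /=]; last first.
  rewrite !inE => /or3P[] /eqP[-> ->]; split=> //=.
  - by rewrite lcmn1.
  - by rewrite lcm1n.
  - by rewrite /lcmn gcdnn mulnK.
have kp : k %| p by rewrite -klp dvdn_lcml.
have lp : l %| p by rewrite -klp dvdn_lcmr.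
rewrite !inE !xpair_eqE; move/primeP: (pp) => [_ dvdp].
case/orP: (dvdp _ kp) (dvdp _ lp) klp => /eqP-> /orP[] /eqP->;
  rewrite ?eqxx ?orbT // => p1.
(* The surviving case [k = l = 1] would give [p = 1]. *)
by rewrite -p1 in pp.
Qed.

Lemma cc_prod_prime p : prime p -> cc_finite p G -> cc_finite p H ->
  cc_finite p (G * H)%type /\
  cc p (G * H)%type = cc p G + cc p H + cc p G * cc p H.
Proof.
move=> pp fG fH; have [] := cc_prod (prime_gt0 pp).
  move=> k l k0 l0 klp; have : lcm_pairs p (k, l) by [].
  rewrite lcm_pairs_prime //= !inE => /or3P[] /eqP[-> ->];
    by split=> //; exact: cc_finite1.
move=> fP ->; split=> //.
rewrite lcm_pairs_prime // -fsbig_seq; last first.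
  (* The three pairs are distinct because [p] is not 1. *)
  by rewrite /= !inE !xpair_eqE eqxx !andbT; case: p pp {fG fH fP} => [|[]].
by rewrite !big_cons big_nil /= !cc1 muln1 mul1n addn0 addnA.
Qed.

End DirectProduct.

(** * Conjugacy classes of a retract *)

Section Retracts.
Local Open Scope group_scope.
Local Open Scope classical_set_scope.
Variables (G K : groupType) (f : UMagmaMorphism.type G K).
Variable r : UMagmaMorphism.type K G.
Hypothesis fK : cancel f r.

(** Defined on sets rather than on representatives, so that mapping classes of [G] to classes of [K]
    requires no choice. *)
Definition conj_saturation (A : set G) : set K :=
  \bigcup_(x in A) conj_class (f x).

Lemma conj_saturation_class x :
  conj_saturation (conj_class x) = conj_class (f x).
Proof.
apply/seteqP; split=> [z [_ [g _ <-]]|z]; first by rewrite gmulfJ conj_classJ.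
by exists x => //; exact: conj_class_refl.
Qed.

(** The retraction recovers a class of [G] from the class it generates in [K], so distinct classes
    of [G] do not fuse in [K]. *)
Lemma retract_conj_class x : r @` conj_class (f x) = conj_class x.
Proof.
apply/seteqP; split=> [_ [_ [g _ <-] <-]|_ [g _ <-]].
  by exists (r g); rewrite ?gmulfJ ?fK.
by exists (f (x ^ g)); [exists (f g); rewrite ?gmulfJ | rewrite fK].
Qed.

Lemma conj_saturation_inj m : set_inj (classes_of_order G m) conj_saturation.
Proof.
move=> _ _ /set_mem[x _ <-] /set_mem[y _ <-]; rewrite !conj_saturation_class.
by move=> xy; rewrite -(retract_conj_class x) xy retract_conj_class.
Qed.

Lemma conj_saturation_order m x :
  has_order m x -> classes_of_order K m (conj_class (f x)).
Proof.
by move=> xm; exists (f x) => //; apply/has_order_inj => //; exact: can_inj fK.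
Qed.

End Retracts.

(** * Torsion elements of the free product *)

Section FreeProductTorsion.
Local Open Scope group_scope.
Variables G H : groupType.
Implicit Types (a b : G + H) (s u v w : seq (G + H)).

Lemma lmul_reduced a w : reduced (a :: w) -> lmul a w = a :: w.
Proof.
move=> rw; have := wordM0 rw.
by rewrite /= -/(wordM w [::]) (wordM0 (reduced_tl rw)).
Qed.

Lemma wordM_reduced u v : reduced (u ++ v) -> wordM u v = u ++ v.
Proof.
elim: u => //= a u IH ruv; rewrite -/(wordM u v) IH ?lmul_reduced //.
exact: reduced_tl ruv.
Qed.

Lemma reduced_cat a b u v : reduced (rcons u a) -> reduced (b :: v) ->
  Defs.is_left a != Defs.is_left b -> reduced (rcons u a ++ b :: v).
Proof.
elim: u => [|c [|d u] IH] /= ru rv ab.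
- by rewrite reduced_cons ab rv -reduced1 ru.
- move: ru; rewrite reduced_cons => /and3P[? ? ra].
  by rewrite reduced_cons; apply/and3P; split=> //; exact: IH.
- move: ru; rewrite reduced_cons => /and3P[? ? rd].
  by rewrite reduced_cons; apply/and3P; split=> //; exact: IH.
Qed.

Lemma reduced_rcons s b : reduced (rcons s b) -> reduced s /\ reduced [:: b].
Proof.
elim: s => [|a [|c s] IH] /= rs; first by [].
  by rewrite reduced1; move: rs; rewrite reduced_cons => /and3P[-> _ ->].
by move: rs; rewrite 2!reduced_cons => /and3P[-> -> /IH].
Qed.

Lemma size_lmul a w : size (lmul a w) <= (size w).+1.
Proof.
rewrite /lmul; case: ifP => // _; case: w => // b w.
by case: letterM => // c; case: ifP => //= _; rewrite ltnW.
Qed.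

Lemma size_wordM u v : size (wordM u v) <= size u + size v.
Proof. by elim: u => //= a u IH; apply: leq_trans (size_lmul _ _) _. Qed.

Definition fp_letter a : free_prod G H := FreeProd (reduced_lmul0 a).

Lemma fp_letterM a b : Defs.is_left a = Defs.is_left b ->
  exists c, fp_letter a * fp_letter b = fp_letter c.
Proof.
by case: a b => [x|x] [y|y] // _; [exists (inl (x * y)) | exists (inr (x * y))];
  apply/val_inj/esym/lmul0M.
Qed.

Lemma fp_letter_cons a w (rw : reduced (a :: w)) :
  FreeProd rw = fp_letter a * FreeProd (reduced_tl rw).
Proof.
apply/val_inj => /=; rewrite wordM_lmul ?(reduced_tl rw) //=.
by rewrite lmul_reduced.
Qed.

Lemma fp_letter_rcons s b (rs : reduced (rcons s b)) (rs' : reduced s) :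
  FreeProd rs = FreeProd rs' * fp_letter b.
Proof.
apply/val_inj => /=; have [_ rb] := reduced_rcons rs.
by rewrite (lmul_reduced rb) wordM_reduced cats1.
Qed.

(** The last letter [b] and the first letter [a] come from different factors, so prepending another
    copy of the word gives a reduced word by mere concatenation. Remembering the first letter
    suffices for the induction and shows that the power is not the empty word. *)
Lemma cyclically_reduced_expg a b s (rw : reduced (a :: rcons s b)) n :
  Defs.is_left b != Defs.is_left a ->
  exists t, fp_word (FreeProd rw ^+ n.+1) = a :: t.
Proof.
move=> ab; elim: n => [|n [t IH]]; first by exists (rcons s b).
exists (rcons s b ++ a :: t); rewrite expgS /= IH.
apply: (@wordM_reduced (rcons (a :: s) b)); apply: reduced_cat => //.
by rewrite -IH; exact: fp_wordP.
Qed.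

(** Strong induction on the length of the reduced word, comparing its first and last letters. *)
Lemma free_prod_torsion n (w : free_prod G H) : w ^+ n.+1 = 1 ->
  exists g a, w ^ g = fp_letter a.
Proof.
have [k] := ubnP (size w); elim: k => // k IH in w *.
case: w => -[|a w] rw; rewrite ltnS => sw wn.
  (* The empty word counts as a letter: [fp_letter] sends a trivial letter to the identity. *)
  exists 1, (inl 1); rewrite conjg1; apply/val_inj => /=.
  by rewrite /lmul /= eqxx.
case: (lastP w) rw sw wn => [|s b] rw sw wn.
  by exists 1, a; rewrite conjg1; apply/val_inj; rewrite /= lmul_reduced.
have [ba|ba] := eqVneq (Defs.is_left b) (Defs.is_left a); last first.
  have [t] := cyclically_reduced_expg rw n ba.
  by rewrite wn.
(* Conjugating [a s b] by [a] gives [s (b a)], where [b a] is a single, possibly trivial, letter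
   [c]; the length drops by at least one. *)
have [rs _] := reduced_rcons (reduced_tl rw).
have [c bac] := fp_letterM ba.
have e : FreeProd rw ^ fp_letter a = FreeProd rs * fp_letter c.
  by rewrite fp_letter_cons (fp_letter_rcons _ rs) conjgE -!mulgA mulKg -bac.
have [||g [d gd]] := IH (FreeProd rw ^ fp_letter a).
- rewrite e /=; apply: leq_ltn_trans (size_wordM _ _) _.
  apply: leq_ltn_trans (leq_add (leqnn _) (size_lmul _ _)) _.
  by move: sw; rewrite /= size_rcons addn1.
- by rewrite -conjXg wn conj1g.
- by exists (fp_letter a * g), d; rewrite conjgM.
Qed.

End FreeProductTorsion.

(** * Conjugacy classes of the free product *)

Section FreeProductClasses.
Local Open Scope classical_set_scope.
Variables G H : groupType.

Lemma multiplicative1 (K L : groupType) (f : {multiplicative K -> L}) :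
  f 1%g = 1%g.
Proof. by apply: (mulgI (f 1%g)); rewrite -gmulfM !mulg1. Qed.

(** Bridges the multiplicative maps given by the universal property to the unit-preserving morphisms
    used for orders and retracts. *)
Definition umagma_morphism (K L : groupType) (f : {multiplicative K -> L}) :
    UMagmaMorphism.type K L :=
  HB.pack (Multiplicative.sort f) (Multiplicative.class f)
    (Multiplicative_isUMagmaMorphism.Build K L f (multiplicative1 f)).

Lemma cst1M (K L : groupType) :
  {morph (fun _ : K => 1%g : L) : x y / (x * y)%g}.
Proof. by move=> x y; rewrite mulg1. Qed.

Definition trivial_morphism (K L : groupType) : {multiplicative K -> L} :=
  HB.pack (fun _ : K => 1%g : L) (isMultiplicative.Build K L _ (@cst1M K L)).

Lemma id_mulgM (K : groupType) : {morph (@id K) : x y / (x * y)%g}.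
Proof. by []. Qed.

Definition id_morphism (K : groupType) : {multiplicative K -> K} :=
  HB.pack (@id K) (isMultiplicative.Build K K id (@id_mulgM K)).

Definition inlM := umagma_morphism (@fp_inl G H : {multiplicative _ -> _}).
Definition inrM := umagma_morphism (@fp_inr G H : {multiplicative _ -> _}).

(** The universal property is applied to the identity of [G] and the trivial map on [H]; that this
    retraction kills [H] later separates the classes of the two factors. *)
Lemma fp_retractl : exists r : UMagmaMorphism.type (free_prod G H) G,
  cancel inlM r /\ forall y, r (inrM y) = 1%g.
Proof.
have [phi [pl pr _]] :=
  free_prod_universal (id_morphism G) (trivial_morphism H G).
by exists (umagma_morphism phi).
Qed.

Lemma fp_retractr : exists r : UMagmaMorphism.type (free_prod G H) H,
  cancel inrM r.
Proof.
have [phi [_ pr _]] :=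
  free_prod_universal (trivial_morphism G H) (id_morphism H).
by exists (umagma_morphism phi).
Qed.

Lemma classes_of_order_free_prod m : 0 < m ->
  classes_of_order (free_prod G H) m =
  conj_saturation inlM @` classes_of_order G m `|`
  conj_saturation inrM @` classes_of_order H m.
Proof.
move=> m0; have [r [lK _]] := fp_retractl; have [r' rK] := fp_retractr.
apply/seteqP; split=> [_ [w /= wm <-]|C].
  (* [free_prod_torsion] expects an exponent of the form [n.+1], hence the rewriting of [m] as the
     successor of its predecessor. *)
  have [_ wn _] := wm; rewrite -(prednK m0) in wn.
  have [g [a wga]] := free_prod_torsion wn.
  rewrite -(conj_classJ w g) wga; rewrite -(has_orderJ _ w g) wga in wm.
  case: a {wga} wm => [x|y] am; [left|right].
    exists (conj_class x); last exact: (conj_saturation_class inlM).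
    exists x => //; apply/(has_order_inj (f := inlM)) => //.
    exact: can_inj lK.
  exists (conj_class y); last exact: (conj_saturation_class inrM).
  exists y => //; apply/(has_order_inj (f := inrM)) => //.
  exact: can_inj rK.
case=> -[_ [x xm <-] <-]; rewrite conj_saturation_class.
  exact: (conj_saturation_order lK).
exact: (conj_saturation_order rK).
Qed.

Lemma cc_free_prod m : 1 < m -> cc_finite m G -> cc_finite m H ->
  cc_finite m (free_prod G H) /\ cc m (free_prod G H) = cc m G + cc m H.
Proof.
move=> m1 fG fH; have [r [lK r1]] := fp_retractl; have [r' rK] := fp_retractr.
rewrite /cc_finite /cc classes_of_order_free_prod ?(ltnW m1) //.
split; first by rewrite finite_setU; split; exact: finite_image.
rewrite card_fset_setU; try exact: finite_image.
  by rewrite (card_fset_set_image fG (conj_saturation_inj lK (m := m)))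
             (card_fset_set_image fH (conj_saturation_inj rK (m := m))).
move=> _ [[_ [x xm <-] <-] [_ [y ym <-]]]; rewrite !conj_saturation_class => xy.
(* If a class from [G] met one from [H], [inlM x] would be conjugate to [inrM y]; applying [r] makes
   [x] a conjugate of 1, so [x] would have order 1, against [1 < m]. *)
have [g _ /(congr1 r)] : conj_class (inrM y) (inlM x).
  by rewrite xy; exact: conj_class_refl.
rewrite gmulfJ lK r1 conj1g => x1; have /has_order1 : x = 1%g by [].
by move/(has_order_unique xm) => m_eq; rewrite m_eq in m1.
Qed.

End FreeProductClasses.

Theorem theorem1p6 (G H : groupType) (m : nat) (hm : 2 <= m) :
  [/\ cc_finite m G -> cc_finite m H ->
        cc_finite m (free_prod G H) /\
        cc m (free_prod G H) = cc m G + cc m H,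
      (forall k l : nat, 0 < k -> 0 < l -> lcmn k l = m ->
         cc_finite k G /\ cc_finite l H) ->
        cc_finite m (G * H)%type /\
        cc m (G * H)%type =
          \big[addn/0]_(p \in [set p : nat * nat |
              [/\ 0 < p.1, 0 < p.2 & lcmn p.1 p.2 = m]]%classic)
            (cc p.1 G * cc p.2 H) &
      forall p : nat, prime p -> cc_finite p G -> cc_finite p H ->
        cc_finite p (G * H)%type /\
        cc p (G * H)%type = cc p G + cc p H + cc p G * cc p H].
Proof.
split; first exact: cc_free_prod; first exact: cc_prod (ltnW hm).
exact: cc_prod_prime.
Qed.
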